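(* Let $n_A$ be a positive integer. The transmission of an $n_A$-dimensional quantum system can be simulated by the transmission of an $n_A$-valued classical message assisted non-adaptively by arbitrary non-signaling correlations. That is, let $\mathcal S$ be the set of all density operators on $\mathbb C^{n_A}$ and let $\mathcal M$ be the set of all POVMs $\mathsf M=\{B_b\}_{b=0}^{n_B-1}$ on $\mathbb C^{n_A}$ with any finite number $n_B$ of outcomes. Then there exist a countable set $\mathcal B$, a non-signaling box $p(a\beta|\rho\,\mathsf M)$ with Alice's input $\rho\in\mathcal S$ and output $a\in[n_A]$, and Bob's input $\mathsf M\in\mathcal M$ and output $\beta\in\mathcal B$, and a conditional probability distribution $p(b|a\beta)$ on the nonnegative integers, such that for every $\rho\in\mathcal S$, every $\mathsf M=\{B_b\}_{b=0}^{n_B-1}\in\mathcal M$ and every $b\in[n_B]$, $$\operatorname{Tr}(\rho B_b)=\sum_{a=0}^{n_A-1}\sum_{\beta\in\mathcal B}p(a\beta|\rho\,\mathsf M)\,p(b|a\beta).$$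
   Context: For a positive integer $n$, $[n]:=\{0,1,\dots,n-1\}$. A POVM on $\mathbb C^{n_A}$ with $n_B$ outcomes is a tuple $\{B_b\}_{b=0}^{n_B-1}$ of positive semidefinite operators summing to the identity. A non-signaling box with (possibly infinite) input sets $\mathcal S,\mathcal M$ and countable output sets is a family of probability distributions $p(\cdot,\cdot|\rho\,\mathsf M)$ on the product of the output sets, one for each pair of inputs $(\rho,\mathsf M)$, such that $\sum_\beta p(a\beta|\rho\,\mathsf M)$ does not depend on $\mathsf M$ and $\sum_a p(a\beta|\rho\,\mathsf M)$ does not depend on $\rho$. The assistance is called non-adaptive because Bob's input to the box (here $\mathsf M$) does not depend on the message $a$ received from Alice; the message is only used in the final post-processing $p(b|a\beta)$. *)

(* Defs.v *)
From HB Require Import structures.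
From mathcomp Require Import all_boot all_order all_algebra.
From mathcomp Require Import sesquilinear spectral.
From mathcomp Require Import all_classical all_reals all_analysis.
From mathcomp Require Import complex.

Set Implicit Arguments.
Unset Strict Implicit.
Unset Printing Implicit Defensive.

Import Order.TTheory GRing.Theory Num.Theory.

Local Open Scope classical_set_scope.
Local Open Scope complex_scope.
Local Open Scope ring_scope.

(* On [R[i]], [0 <= z] means that z is real and nonnegative; hence the
   condition forces A to be Hermitian. *)
Definition psdmx (R : realType) (n : nat) (A : 'M[R[i]]_n) : Prop :=
  forall v : 'cV[R[i]]_n, 0 <= ((v ^t*)%sesqui *m A *m v) 0 0.

Record density (R : realType) (n : nat) := Density {
  density_mx :> 'M[R[i]]_n;
  density_psd : psdmx density_mx;
  density_tr : \tr density_mx = 1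
}.

(* The number of outcomes is a field, so that [povm R n] collects the POVMs
   with any finite number of outcomes. *)
Record povm (R : realType) (n : nat) := Povm {
  outcomes : nat;
  effect :> 'I_outcomes -> 'M[R[i]]_n;
  effect_psd : forall b, psdmx (effect b);
  effect_sum : \sum_b effect b = 1%:M
}.

Definition is_distr (R : realType) (T : countType) (p : T -> R) : Prop :=
  (forall x, 0 <= p x) /\ \esum_(x in [set: T]) (p x)%:E = 1%:E.

Definition nonsignaling (R : realType) (S M : Type) (A B : countType)
    (p : S -> M -> A * B -> R) : Prop :=
  [/\ forall s m, is_distr (p s m),
      forall s m m' a,
        \esum_(beta in [set: B]) (p s m (a, beta))%:E
        = \esum_(beta in [set: B]) (p s m' (a, beta))%:E
    & forall s s' m beta,
        \esum_(a in [set: A]) (p s m (a, beta))%:E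
        = \esum_(a in [set: A]) (p s' m (a, beta))%:E].

(* Main.v *)
Require Import Defs.
From mathcomp Require Import all_boot all_order all_fingroup all_algebra.
From mathcomp Require Import sesquilinear spectral.
From mathcomp Require Import all_classical all_reals all_analysis.
From mathcomp Require Import complex.

(* A POVM can be refined to rank one effects [u x (u x)^*].  Bob draws an n-tuple F of
   indices with probability [|det (u (F 0), ..., u (F (n-1)))|^2 / n!]; by Cauchy-Binet F
   avoids a set S with probability [det (1 - B_S)], where [B_S] is the sum of the effects
   in S.  Since [0 <= 1 - B_S <= 1], that determinant is at most [1 - Tr (rho B_S)], so F
   meets S with probability at least [Tr (rho B_S)].  This is Hall's condition: for each
   rho there is a coupling of F with a position a such that F a follows the law of the
   measurement.  A shared cyclic shift of the positions makes a uniform; Bob's output is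
   the list of the n outcomes, and the message a selects one of them. *)

Set Implicit Arguments.
Unset Strict Implicit.
Unset Printing Implicit Defensive.

Import Order.TTheory GRing.Theory Num.Theory.

Local Open Scope ring_scope.

(** * Fractional Hall theorem *)

Section Transport.
Variables (R : realFieldType) (F X : finType) (E : F -> {set X}).
Implicit Types (P : F -> R) (w : X -> R) (S T : {set X}).

Definition hits S (f : F) := E f :&: S != finset.set0.

Definition hall_condition P w :=
  forall S, \sum_(x in S) w x <= \sum_(f | hits S f) P f.

(** The supplies [P f] are only upper bounds here; equality is recovered in
    [determinantal_coupling], where both total masses are 1. *)
Definition transport P w (g : F -> X -> R) :=
  [/\ forall f x, 0 <= g f x,
      forall f x, x \notin E f -> g f x = 0,
      forall x, \sum_f g f x = w x
    & forall f, \sum_x g f x <= P f].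

Definition hall_size P w := (#|[set f | P f != 0%R]| + #|[set x | w x != 0%R]|)%N.

Lemma hitsU S T f : hits (S :|: T) f = hits S f || hits T f.
Proof. by rewrite /hits finset.setIUr finset.setU_eq0 negb_and. Qed.

Lemma hitsS S T f : S \subset T -> hits S f -> hits T f.
Proof.
by move=> sST; apply: contraNneq => h; rewrite -finset.subset0 -h finset.setIS.
Qed.

Lemma hits1 x f : hits [set x] f = (x \in E f).
Proof.
rewrite /hits; apply/finset.set0Pn/idP => [[y]|xf]; last by exists x; rewrite !inE xf eqxx.
by rewrite !inE => /andP[yf /eqP <-].
Qed.

(** Demands in [S] use up all supply able to reach [S], so the problem decouples into sources
    hitting [S] with demands in [S], and the remaining sources with the remaining demands. The
    points [y] and [x] make both halves strictly smaller, so the induction hypothesis of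
    [weighted_hall], passed as the last premise, applies to each. *)
Lemma tight_split P w S n :
    (forall f, 0 <= P f) -> (forall x, 0 <= w x) -> hall_condition P w ->
    \sum_(x in S) w x = \sum_(f | hits S f) P f ->
    (exists2 y, y \in S & w y != 0) -> (exists2 x, x \notin S & w x != 0) ->
    (hall_size P w <= n.+1)%N ->
    (forall P w, (forall f, 0 <= P f) -> (forall x, 0 <= w x) ->
       hall_condition P w -> (hall_size P w <= n)%N -> exists g, transport P w g) ->
  exists g, transport P w g.
Proof.
move=> P0 w0 hall tight [y yS wy] [x xS wx] size_n IH.
pose P1 f := if hits S f then P f else 0; pose w1 x := if x \in S then w x else 0.
pose P2 f := if hits S f then 0 else P f; pose w2 x := if x \in S then 0 else w x.
have sumw1 T : \sum_(x in T) w1 x = \sum_(x in T :&: S) w x.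
  by rewrite -big_mkcondr; apply: eq_bigl => z; rewrite !inE.
have sumw2 T : \sum_(x in T) w2 x = \sum_(x in T :\: S) w x.
  rewrite (eq_bigr (fun x => if x \notin S then w x else 0)) => [|z _].
    by rewrite -big_mkcondr; apply: eq_bigl => z; rewrite !inE andbC.
  by rewrite /w2; case: (z \in S).
have sumP1 T : \sum_(f | hits T f) P1 f = \sum_(f | hits T f && hits S f) P f.
  by rewrite -big_mkcondr.
have sumP2 T : \sum_(f | hits T f) P2 f = \sum_(f | hits T f && ~~ hits S f) P f.
  rewrite (eq_bigr (fun f => if ~~ hits S f then P f else 0)) => [|z _].
    by rewrite -big_mkcondr.
  by rewrite /P2; case: (hits S z).
have [||||g1 [g10 g1E g1w g1P]] := IH P1 w1.
- by move=> f; rewrite /P1; case: ifP.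
- by move=> z; rewrite /w1; case: ifP.
(* Hall's condition for [T :&: S]: a source hitting it hits both [T] and [S]. *)
- move=> T; rewrite sumw1 sumP1; apply: le_trans (hall _) _.
  rewrite [leRHS](bigID (hits (T :&: S))) /=.
  rewrite [X in _ <= X + _](eq_bigl (hits (T :&: S))) ?lerDl ?sumr_ge0//.
  move=> f; case h: (hits (T :&: S) f); rewrite ?andbF// andbT.
  by rewrite !(hitsS _ h) ?finset.subsetIl ?finset.subsetIr.
- rewrite -ltnS; apply: leq_trans size_n; rewrite /hall_size -addnS leq_add//.
    apply/subset_leq_card/fintype.subsetP => f; rewrite !inE /P1.
    by case: ifP => //; rewrite eqxx.
  apply/proper_card/properP; split.
    by apply/fintype.subsetP => z; rewrite !inE /w1; case: ifP => //; rewrite eqxx.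
  by exists x; rewrite !inE ?wx// /w1 (negbTE xS) eqxx.
have [||||g2 [g20 g2E g2w g2P]] := IH P2 w2.
- by move=> f; rewrite /P2; case: ifP.
- by move=> z; rewrite /w2; case: ifP.
(* Hall's condition for [T :|: S], minus the equality for the tight set [S]. *)
- move=> T; rewrite sumw2 sumP2.
  have := hall (T :|: S).
  rewrite (bigID (mem S)) /= (eq_bigl (mem S)) => [|z]; last first.
    by rewrite !inE; case: (z \in S); rewrite ?andbF ?orbT.
  rewrite tight [leRHS](bigID (hits S)) /=.
  rewrite (eq_bigl (hits S)) => [|f]; last first.
    by rewrite hitsU; case: (hits S f); rewrite ?andbF ?orbT.
  rewrite [leRHS](_ : _ = \sum_(f | hits S f) P f + \sum_(f | hits T f && ~~ hits S f) P f).
    rewrite lerD2l => h; apply: le_trans h; rewrite le_eqVlt; apply/orP; left; apply/eqP.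
    by apply: eq_bigl => z; rewrite !inE; case: (z \in S); rewrite ?andbF ?andbT ?orbF.
  congr (_ + _); apply: eq_bigl => f; rewrite hitsU; case: (hits S f); rewrite ?andbF ?orbT ?orbF//.
- rewrite -ltnS; apply: leq_trans size_n; rewrite /hall_size -addnS leq_add//.
    apply/subset_leq_card/fintype.subsetP => f; rewrite !inE /P2.
    by case: ifP => //; rewrite eqxx.
  apply/proper_card/properP; split.
    by apply/fintype.subsetP => z; rewrite !inE /w2; case: ifP => //; rewrite eqxx.
  by exists y; rewrite !inE ?wy// /w2 yS eqxx.
exists (fun f x => g1 f x + g2 f x); split.
- by move=> f z; rewrite addr_ge0.
- by move=> f z zf; rewrite g1E ?g2E ?addr0.
- by move=> z; rewrite big_split /= g1w g2w /w1 /w2; case: ifP; rewrite ?addr0 ?add0r.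
- move=> f; rewrite big_split /=; apply: le_trans (lerD (g1P f) (g2P f)) _.
  by rewrite /P1 /P2; case: ifP; rewrite ?addr0 ?add0r.
Qed.

Lemma sum_sub_delta (T : finType) (A : {pred T}) (h : T -> R) (i : T) (t : R) :
  \sum_(j in A) (h j - (if j == i then t else 0))
  = \sum_(j in A) h j - (if i \in A then t else 0).
Proof.
rewrite sumrB; congr (_ - _); case: ifP => iA.
  rewrite (bigD1 i) //= eqxx big1 ?addr0// => j /andP[_ /negbTE->] //.
by rewrite big1// => j jA; case: eqP => // ji; rewrite ji iA in jA.
Qed.

(* Ford-Fulkerson without augmenting paths: push along one edge as much as
   Hall's condition allows; either a supply or a demand is exhausted or a tight
   set appears, along which the problem splits. *)
Lemma weighted_hall P w : (forall f, 0 <= P f) -> (forall x, 0 <= w x) ->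
  hall_condition P w -> exists g, transport P w g.
Proof.
move: {2}(hall_size P w) (leqnn (hall_size P w)) => n.
elim: n P w => [|n IH] P w size_n P0 w0 hall.
  exists (fun _ _ => 0); split=> // [x|f]; last by rewrite big1.
  rewrite big1//; apply/esym/eqP; move: size_n; rewrite leqn0 addn_eq0 => /andP[_].
  by rewrite cards_eq0 => /eqP/setP/(_ x); rewrite !inE => /negbFE.
have {}IH P' w' : (forall f, 0 <= P' f) -> (forall x, 0 <= w' x) ->
    hall_condition P' w' -> (hall_size P' w' <= n)%N -> exists g, transport P' w' g.
  by move=> *; apply: IH.
have [/existsP[x wx]|] := boolP [exists x, w x != 0]; last first.
  rewrite negb_exists => /forallP w_eq0; exists (fun _ _ => 0); split=> // [x|f].
    by rewrite big1//; apply/esym/eqP; rewrite -[_ == _]negbK.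
  by rewrite big1.
have wx_gt0 : 0 < w x by rewrite lt_def wx w0.
have /existsP[f /andP[xf Pf]] : [exists f, (x \in E f) && (P f != 0)].
  apply: contraLR wx_gt0; rewrite negb_exists => /forallP h; rewrite -leNgt.
  have := hall [set x]; rewrite big_set1 => /le_trans; apply.
  rewrite big1// => f; rewrite hits1 => xf; have := h f; rewrite xf /=.
  by move/negbNE/eqP.
have Pf_gt0 : 0 < P f by rewrite lt_def Pf P0.
pose slack S := \sum_(f | hits S f) P f - \sum_(x in S) w x.
(* Moving mass from [f] to [x] reduces the slack of exactly these sets, so [t] is the largest push
   that keeps Hall's condition and nonnegativity. *)
pose cut S := (x \notin S) && hits S f.
pose t := \big[Order.min/Order.min (w x) (P f)]_(S | cut S) slack S.
have t_wx : t <= w x by rewrite (le_trans (bigmin_le_id _ _ _ _))// ge_min lexx.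
have t_Pf : t <= P f by rewrite (le_trans (bigmin_le_id _ _ _ _))// ge_min lexx orbT.
have t_slack S : cut S -> t <= slack S by move=> cS; exact: bigmin_le_cond.
have t_ge0 : 0 <= t.
  apply: le_bigmin => [|S _]; first by rewrite le_min w0 P0.
  by rewrite subr_ge0.
pose P' f' := P f' - (if f' == f then t else 0).
pose w' x' := w x' - (if x' == x then t else 0).
have P'0 f' : 0 <= P' f'.
  by rewrite /P'; case: eqP => [->|_]; rewrite ?subr0// subr_ge0.
have w'0 x' : 0 <= w' x'.
  by rewrite /w'; case: eqP => [->|_]; rewrite ?subr0// subr_ge0.
have sumP' S : \sum_(f | hits S f) P' f = \sum_(f | hits S f) P f - (if hits S f then t else 0).
  exact: sum_sub_delta.
have sumw' S : \sum_(x in S) w' x = \sum_(x in S) w x - (if x \in S then t else 0).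
  exact: sum_sub_delta.
have hall' : hall_condition P' w'.
  move=> S; rewrite sumP' sumw'; have [xS|xS] := boolP (x \in S).
    have -> : hits S f by apply/finset.set0Pn; exists x; rewrite inE xf.
    by rewrite lerD2r.
  rewrite subr0; case: ifP => hS; last by rewrite subr0.
  by rewrite lerBrDr -lerBrDl t_slack // /cut xS.
have supP : [set f | P' f != 0] \subset [set f | P f != 0].
  apply/fintype.subsetP => f'; rewrite !inE /P'.
  by have [->|_] := eqVneq f' f; rewrite ?subr0.
have supw : [set x | w' x != 0] \subset [set x | w x != 0].
  apply/fintype.subsetP => x'; rewrite !inE /w'.
  by have [->|_] := eqVneq x' x; rewrite ?subr0.
have size'_le : (hall_size P' w' <= hall_size P w)%N by rewrite leq_add// subset_leq_card.
(* A transport of the reduced problem is completed by putting the mass [t] back on the edge from [f]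
   to [x]. *)
suff [g [g0 gE gw gP]] : exists g, transport P' w' g.
  exists (fun f' x' => g f' x' + (if (f' == f) && (x' == x) then t else 0)); split.
  - by move=> f' x'; rewrite addr_ge0//; case: ifP.
  - move=> f' x' x'f'; rewrite gE// add0r; case: andP => // -[/eqP ff /eqP xx].
    by rewrite ff xx xf in x'f'.
  - move=> x'; rewrite big_split /= gw /w'; case: eqP => _; last first.
      by rewrite big1 ?addr0 ?subr0// => f' _; rewrite andbF.
    by under eq_bigr do rewrite andbT; rewrite -big_mkcond big_pred1_eq subrK.
  - move=> f'; rewrite big_split /= (le_trans (lerD (gP f') (lexx _)))// /P'.
    case: eqP => _ /=; last by rewrite big1 ?addr0 ?subr0.
    by rewrite -big_mkcond big_pred1_eq subrK.
have [w'x|w'x] := eqVneq (w' x) 0.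
  apply: IH => //; rewrite -ltnS; apply: leq_trans size_n; rewrite /hall_size -addnS.
  rewrite leq_add ?subset_leq_card//; apply/proper_card/properP; split=> //.
  by exists x; rewrite !inE ?w'x ?eqxx.
have [P'f|P'f] := eqVneq (P' f) 0.
  apply: IH => //; rewrite -ltnS; apply: leq_trans size_n; rewrite /hall_size -addSn.
  rewrite leq_add ?subset_leq_card//; apply/proper_card/properP; split=> //.
  by exists f; rewrite !inE ?P'f ?eqxx.
(* Neither [f] nor [x] is exhausted, so the minimum is attained at a cut set, which is tight after
   the push. *)
have [S cS tS] : exists2 S, cut S & t = slack S.
  have : [\/ t = w x, t = P f | exists2 S, cut S & t = slack S].
    rewrite /t; elim/big_rec: _ => [|S u cS IHu].
      by rewrite minEle; case: ifP => _; [constructor 1|constructor 2].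
    by rewrite minEle; case: ifP => _ //; constructor 3; exists S.
  case=> // tE; first by rewrite /w' eqxx tE subrr eqxx in w'x.
  by rewrite /P' eqxx tE subrr eqxx in P'f.
have [xS hSf] := andP cS.
apply: (@tight_split P' w' S n) => //; last 2 first.
- by exists x.
- exact: leq_trans size_n.
- by rewrite sumP' sumw' hSf (negbTE xS) subr0 tS /slack subKr.
(* The split needs demand inside [S]. Without any, the slack of [S] would be at least [P f], and the
   push would have exhausted [f]. *)
have [/existsP[y /andP[yS wy]]|] := boolP [exists y, (y \in S) && (w' y != 0)].
  by exists y.
rewrite negb_exists => /forallP h; exfalso.
have wS0 : \sum_(x in S) w x = 0.
  have : \sum_(x in S) w' x = 0.
    by rewrite big1// => y yS; have := h y; rewrite yS /= => /negbNE/eqP.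
  by rewrite sumw' (negbTE xS) subr0.
case/negP: P'f; rewrite /P' eqxx subr_eq0 eq_le t_Pf andbT.
by rewrite tS /slack wS0 subr0 (bigD1 f) //= lerDl sumr_ge0.
Qed.

End Transport.

(** * Positive semidefinite matrices *)

Local Open Scope sesquilinear_scope.

Section Psd.
Variable C : numClosedFieldType.

Definition quad n (A : 'M[C]_n) (v : 'cV[C]_n) : C := (v ^t* *m A *m v) 0 0.

Definition psd n (A : 'M[C]_n) := forall v, 0 <= quad A v.

Lemma delta_mx_mulmx_delta m n (A : 'M[C]_(m, n)) i j :
  (delta_mx (0 : 'I_1) i *m A *m delta_mx j (0 : 'I_1)) 0 0 = A i j.
Proof. by rewrite -rowE -colE !mxE. Qed.

Lemma trmxC_mul m n p (A : 'M[C]_(m, n)) (B : 'M[C]_(n, p)) :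
  (A *m B) ^t* = B ^t* *m A ^t*.
Proof. by rewrite trmx_mul map_mxM. Qed.

Lemma psd_conj m n (A : 'M[C]_n) (U : 'M[C]_(n, m)) : psd A -> psd (U ^t* *m A *m U).
Proof.
by move=> Apsd v; have := Apsd (U *m v); rewrite /quad trmxC_mul !mulmxA.
Qed.

Lemma psd_diag n (A : 'M[C]_n) i : psd A -> 0 <= A i i.
Proof.
move/(_ (delta_mx i 0)); rewrite /quad trmx_delta map_delta_mx.
by rewrite delta_mx_mulmx_delta.
Qed.

Lemma trmxC_add m n (A B : 'M[C]_(m, n)) : (A + B) ^t* = A ^t* + B ^t*.
Proof. by apply/matrixP => i j; rewrite !mxE rmorphD. Qed.

Lemma trmxC_scale m n c (A : 'M[C]_(m, n)) : (c *: A) ^t* = c^* *: A ^t*.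
Proof. by apply/matrixP => i j; rewrite !mxE rmorphM. Qed.

Lemma quad_add n (A : 'M[C]_n) v w :
  quad A (v + w) =
  quad A v + quad A w + ((v ^t* *m A *m w) 0 0 + (w ^t* *m A *m v) 0 0).
Proof.
rewrite /quad trmxC_add !mulmxDl !mulmxDr mxE [X in X + _]mxE [X in _ + X]mxE.
by rewrite [RHS]addrACA [X in _ = _ + X]addrC.
Qed.

(* Polarization with [e_i + e_j] and [e_i + 'i e_j]. *)
Lemma psd_hermitian n (A : 'M[C]_n) : psd A -> A ^t* = A.
Proof.
move=> Apsd; apply/matrixP => i j; rewrite !mxE.
have cross c : c * A i j + c^* * A j i \is Num.real.
  pose v : 'cV[C]_n := delta_mx i 0; pose w : 'cV[C]_n := c *: delta_mx j 0.
  have : quad A (v + w) - (quad A v + quad A w) \is Num.real.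
    by rewrite !(rpredB, rpredD)//; apply: ger0_real.
  rewrite quad_add addrC addKr /v /w trmxC_scale !trmx_delta !map_delta_mx.
  by rewrite -!scalemxAl -!scalemxAr mxE [X in _ + X]mxE !delta_mx_mulmx_delta.
have /CrealP := cross 1; rewrite conjC1 !mul1r rmorphD /= => sum_eq.
have /CrealP := cross 'i; rewrite conjCi rmorphD !rmorphM /= rmorphN /= conjCi.
rewrite opprK !mulNr -mulrBr addrC -mulrBr => /(mulfI (neq0Ci _)) diff_eq.
apply: (@mulfI _ 2); first by rewrite pnatr_eq0.
have : (A i j)^* + (A j i)^* + ((A j i)^* - (A i j)^*) = A i j + A j i + (A i j - A j i).
  by rewrite sum_eq diff_eq.
by rewrite addrC subrKA [A i j + A j i]addrC [RHS]addrC subrKA -!mulr2n !mulr_natl.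
Qed.

Lemma psd_spectral n (A : 'M[C]_n) : psd A ->
  exists (V : 'M[C]_n) (d : 'rV[C]_n), [/\ V *m V ^t* = 1%:M, V ^t* *m V = 1%:M,
    A = V ^t* *m diag_mx d *m V & V *m A *m V ^t* = diag_mx d].
Proof.
move=> Apsd.
have : A \is hermsymmx by apply/is_hermitianmxP; rewrite expr0 scale1r psd_hermitian.
move=> /hermitian_normalmx /orthomx_spectralP.
have VU := spectral_unitarymx A; set V := spectralmx A; set d := spectral_diag A.
rewrite invmx_unitary // => AE; have VV := unitarymxP VU.
exists V, d; split=> //; first exact: mulmx1C.
by rewrite {1}AE !mulmxA VV mul1mx -mulmxA VV mulmx1.
Qed.

(** Scale an orthonormal eigenbasis by the square roots of the eigenvalues. The columns of [U] later
    supply the rank one effects. *)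
Lemma psd_factor n (A : 'M[C]_n) : psd A -> exists U : 'M[C]_n, A = U *m U ^t*.
Proof.
move=> Apsd; have [V [d [VV VV' AE dE]]] := psd_spectral Apsd.
have d_ge0 i : 0 <= d 0 i.
  have := psd_conj (V ^t*) Apsd; rewrite trmxCK dE => /(psd_diag i).
  by rewrite !mxE eqxx.
pose D := diag_mx (\row_i sqrtC (d 0 i)).
have DC : D ^t* = D.
  rewrite /D tr_diag_mx map_diag_mx; congr diag_mx; apply/rowP => i; rewrite !mxE.
  by apply/CrealP; rewrite ger0_real ?sqrtC_ge0.
exists (V ^t* *m D); rewrite trmxC_mul trmxCK DC mulmxA -[_ *m D *m D]mulmxA.
rewrite AE; congr (_ *m _ *m _); apply/matrixP => i j.
rewrite /D mulmx_diag !mxE; congr (_ *+ _).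
by rewrite -expr2 sqrtCK.
Qed.

(* In an eigenbasis of [B], [\tr (rho *m B)] is a weighted mean of the eigenvalues,
   which lie between 0 and 1, so each of them is at least their product. *)
Lemma det_le_mxtrace n (rho B : 'M[C]_n) :
  psd rho -> \tr rho = 1 -> psd B -> psd (1%:M - B) -> \det B <= \tr (rho *m B).
Proof.
move=> rho_psd rho_tr Bpsd B1psd; have [V [d [VV VV' BE dE]]] := psd_spectral Bpsd.
have d_ge0 i : 0 <= d 0 i.
  have := psd_conj (V ^t*) Bpsd; rewrite trmxCK dE => /(psd_diag i).
  by rewrite !mxE eqxx.
have d_le1 i : d 0 i <= 1.
  have := psd_conj (V ^t*) B1psd; rewrite trmxCK mulmxBr mulmxBl mulmx1 VV dE.
  by move=> /(psd_diag i); rewrite !mxE eqxx subr_ge0.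
pose r i := (V *m rho *m V ^t*) i i.
have r_ge0 i : 0 <= r i.
  by have := psd_conj (V ^t*) rho_psd; rewrite trmxCK => /(psd_diag i).
have r_sum : \sum_i r i = 1.
  by rewrite -[LHS]/(\tr (V *m rho *m V ^t*)) mxtrace_mulC mulmxA VV' mul1mx.
have -> : \det B = \prod_i d 0 i.
  rewrite BE !det_mulmx det_diag mulrC mulrA -det_mulmx VV det1 mul1r//.
have -> : \tr (rho *m B) = \sum_i r i * d 0 i.
  rewrite BE !mulmxA mxtrace_mulC !mulmxA; apply: eq_bigr => i _.
  by rewrite mul_mx_diag mxE.
(* The weights [r i] sum to 1, so the determinant is spread over them and compared with the
   eigenvalues one by one. *)
rewrite -[leLHS]mul1r -[X in X * _]r_sum mulr_suml ler_sum// => i _.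
rewrite ler_wpM2l// (bigD1 i) //= ler_piMr//.
by apply: prodr_ile1 => j _; rewrite d_ge0 d_le1.
Qed.

(** * Cauchy-Binet identity over ordered tuples *)

Section CauchyBinet.
Variables (n : nat) (X : finType) (u : X -> 'cV[C]_n).

Definition detw (F : {ffun 'I_n -> X}) : C := `|\det (\matrix_(i, j) u (F i) j 0)| ^+ 2.

Lemma detw_ge0 F : 0 <= detw F.
Proof. exact: exprn_ge0. Qed.

(** Expand the determinant and its conjugate over permutations [s] and [t]; summing over [F] turns
    each product into entries of [G]. Every [s] then contributes one copy of [\det G], whence the
    factorial. *)
Lemma sum_detw (S : {set X}) :
  \sum_(F in ffun_on (mem S)) detw F = n`!%:R * \det (\sum_(x in S) u x *m (u x) ^t*).
Proof.
set G := \sum_(x in S) _.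
have GE i j : G i j = \sum_(x in S) u x i 0 * (u x j 0)^*.
  by rewrite summxE; apply: eq_bigr => x _; rewrite !mxE big_ord1 !mxE.
transitivity (\sum_(s : 'S_n) \sum_(t : 'S_n)
   (-1) ^+ s * (-1) ^+ t * \prod_i G (s i) (t i)).
  transitivity (\sum_(F in ffun_on (mem S)) \sum_(s : 'S_n) \sum_(t : 'S_n)
     (-1) ^+ s * (-1) ^+ t * \prod_i (u (F i) (s i) 0 * (u (F i) (t i) 0)^*)).
    apply: eq_bigr => F _; rewrite /detw normCK /determinant rmorph_sum mulr_suml.
    apply: eq_bigr => s _; rewrite mulr_sumr; apply: eq_bigr => t _.
    rewrite rmorphM rmorph_sign rmorph_prod big_split /= mulrACA.
    by congr (_ * (_ * _)); apply: eq_bigr => i _; rewrite !mxE.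
  rewrite exchange_big; apply: eq_bigr => s _; rewrite exchange_big.
  apply: eq_bigr => t _; rewrite -mulr_sumr; congr (_ * _).
  by under [RHS]eq_bigr do rewrite GE; rewrite bigA_distr_big.
transitivity (\sum_(s : 'S_n) \det G); last by rewrite sumr_const card_Sn mulr_natl.
(* Replacing [t] by [s * t] cancels the sign of [s]; reindexing the product by [s] leaves the
   Leibniz formula for [G]. *)
apply: eq_bigr => s _; rewrite (reindex_inj (mulgI s)) /=; apply: eq_bigr => t _.
rewrite odd_permM signr_addb mulrA -expr2 sqrr_sign mul1r; congr (_ * _).
by rewrite [RHS](reindex_inj (@perm_inj _ s)); apply: eq_bigr => i _; rewrite permM.
Qed.

End CauchyBinet.
End Psd.

Local Close Scope sesquilinear_scope.
Local Open Scope classical_set_scope.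
Local Open Scope complex_scope.
Local Open Scope ring_scope.

(** * Determinantal weights satisfy Hall's condition *)

Definition range_set (n : nat) (X : finType) (F : {ffun 'I_n -> X}) : {set X} :=
  [set F i | i in 'I_n]%SET.

Section Coupling.
Variables (R : realType) (n : nat) (X : finType) (u : X -> 'cV[R[i]]_n).
Hypothesis u_sum : \sum_x u x *m (u x ^t*)%sesqui = 1%:M.
Variable rho : 'M[R[i]]_n.
Hypotheses (rho_psd : psd rho) (rho_tr : \tr rho = 1).

Lemma mxtrace_rank1 x : \tr (rho *m (u x *m (u x ^t*)%sesqui)) = quad rho (u x).
Proof. by rewrite mulmxA mxtrace_mulC mulmxA trace_mx11. Qed.

Lemma psd_sum_rank1 (S : {set X}) : psd (\sum_(x in S) u x *m (u x ^t*)%sesqui).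
Proof.
move=> v; rewrite /quad mulmx_sumr mulmx_suml summxE sumr_ge0 // => x _.
rewrite mulmxA -mulmxA -{2}[v]trmxCK -trmxC_mul !mxE big_ord1 !mxE.
by rewrite -normCK exprn_ge0.
Qed.

Lemma detw_distr : \sum_F detw u F / n`!%:R = 1.
Proof.
have eT : \sum_F detw u F = \sum_(F in ffun_on (mem [set: X]%SET)) detw u F.
  by apply: eq_bigl => F; apply/esym/ffun_onP => i; rewrite inE.
rewrite -mulr_suml eT.
rewrite sum_detw mulrAC divff ?mul1r ?pnatr_eq0 -?lt0n ?fact_gt0//.
by rewrite (eq_bigl predT) ?u_sum ?det1// => x; rewrite inE.
Qed.

Lemma detw_hall (S : {set X}) :
  \sum_(x in S) quad rho (u x)
  <= \sum_(F : {ffun 'I_n -> X} | hits (@range_set n X) S F)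
        detw u F / n`!%:R.
Proof.
have qE T : \sum_(x in T) quad rho (u x)
    = \tr (rho *m \sum_(x in T) u x *m (u x ^t*)%sesqui).
  by rewrite mulmx_sumr raddf_sum; apply: eq_bigr => x _; rewrite /= mxtrace_rank1.
have compl T : \sum_(x in ~: T) u x *m (u x ^t*)%sesqui
    = 1%:M - \sum_(x in T) u x *m (u x ^t*)%sesqui.
  rewrite -u_sum [\sum_x _](bigID (mem T)) /= addrAC subrr add0r.
  by apply: eq_bigl => x; rewrite inE.
(* The determinant bound is applied to the sum of the effects outside [S], which is one minus the
   sum inside. *)
have := det_le_mxtrace rho_psd rho_tr (psd_sum_rank1 (~: S)).
rewrite {1}compl subKr => /(_ (psd_sum_rank1 _)).
rewrite {2}compl mulmxBr mulmx1 linearB /= rho_tr -qE.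
rewrite lerBrDl -lerBrDr => /le_trans; apply.
rewrite -[X in X - _ <= _]detw_distr.
rewrite (bigID (fun F : {ffun 'I_n -> X} => F \in ffun_on (mem (~: S)))) /=.
rewrite -mulr_suml sum_detw mulrAC divff ?mul1r ?pnatr_eq0 -?lt0n ?fact_gt0//.
rewrite addrAC subrr add0r le_eqVlt; apply/orP; left; apply/eqP.
(* A tuple misses [S] exactly when all its entries lie in the complement. *)
apply: eq_bigl => F; apply/negP/idP.
  apply: contra_notT; rewrite negbK => /eqP/setP h; apply/ffun_onP => i.
  by have := h (F i); rewrite !inE imset_f //= => ->.
move=> /finset.set0Pn[x]; rewrite inE => /andP[/imsetP[i _ ->] FS] /ffun_onP/(_ i).
by rewrite inE FS.
Qed.

End Coupling.

Lemma Re_ge0 (R : rcfType) (z : R[i]) : 0 <= z -> 0 <= complex.Re z.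
Proof. by rewrite lecE => /andP[]. Qed.

(* Turns a flow towards the values [x] into a flow towards positions [a]: all the mass
   of [x] goes to one chosen position at which [F] takes the value [x]. *)
Section Aim.
Variables (R : realFieldType) (n : nat) (X : finType).
Local Notation Om := {ffun 'I_n -> X}.

Definition aim (F : Om) x : option 'I_n := [pick i | F i == x].

Lemma aimP F x a : aim F x == Some a -> F a = x.
Proof. by rewrite /aim; case: pickP => // i /eqP Fi /eqP[<-]. Qed.

Definition steer (g : Om -> X -> R) (F : Om) (a : 'I_n) : R :=
  \sum_(x | aim F x == Some a) g F x.

Lemma sum_steer g F : (forall x, x \notin range_set F -> g F x = 0) ->
  \sum_a steer g F a = \sum_x g F x.
Proof.
move=> gE; rewrite /steer (exchange_big_dep predT) //=; apply: eq_bigr => x _.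
case E: (aim F x) => [a|]; first by rewrite (big_pred1 a).
rewrite big_pred0 ?gE//; move: E; rewrite /aim; case: pickP => // Fx _.
by apply/imsetP => -[i _ xE]; have := Fx i; rewrite -xE eqxx.
Qed.

(** The position chosen for a value [y] carries [y], so the positions carrying [x] receive the flow
    towards [x] and no other. *)
Lemma sum_steer_eq g (F : Om) x : (forall x, x \notin range_set F -> g F x = 0) ->
  \sum_(a | F a == x) steer g F a = g F x.
Proof.
move=> gE; rewrite /steer (exchange_big_dep predT) //= (bigD1 x) //= [X in _ + X]big1.
  rewrite addr0; case E: (aim F x) => [a|].
    rewrite (big_pred1 a) // => b /=; apply/andP/eqP => [[_ /eqP[]]//|->].
    by rewrite (aimP (F := F) (x := x)) ?E ?eqxx.
  rewrite big_pred0 => [|b]; last by rewrite andbF.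
  rewrite gE//; move: E; rewrite /aim; case: pickP => // Fx _.
  by apply/imsetP => -[i _ xE]; have := Fx i; rewrite -xE eqxx.
move=> y yx; rewrite big_pred0 // => b; apply/andP => -[/eqP bx /aimP].
by rewrite bx => xy; rewrite xy eqxx in yx.
Qed.

End Aim.

Lemma determinantal_coupling (R : realType) n (X : finType) (u : X -> 'cV[R[i]]_n)
    (rho : 'M[R[i]]_n) :
  \sum_x u x *m (u x ^t*)%sesqui = 1%:M -> psd rho -> \tr rho = 1 ->
  exists h : {ffun 'I_n -> X} -> 'I_n -> R,
    [/\ forall (F : {ffun 'I_n -> X}) a, 0 <= h F a,
        forall F : {ffun 'I_n -> X}, \sum_a h F a = complex.Re (detw u F / n`!%:R)
      & forall x, \sum_(F : {ffun 'I_n -> X}) \sum_(a | F a == x) h F a =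
          complex.Re (quad rho (u x))].
Proof.
move=> u_sum rho_psd rho_tr.
pose P (F : {ffun 'I_n -> X}) := complex.Re (detw u F / n`!%:R).
pose w x := complex.Re (quad rho (u x)).
have P0 F : 0 <= P F by rewrite Re_ge0// divr_ge0 ?detw_ge0.
have w0 x : 0 <= w x by rewrite Re_ge0.
have hall : hall_condition (@range_set n X) P w.
  move=> S; rewrite /P /w -!raddf_sum /=.
  by have := detw_hall u_sum rho_psd rho_tr S; rewrite lecE => /andP[].
have [g [g0 gE gw gP]] := weighted_hall P0 w0 hall.
have sumP : \sum_F P F = 1 by rewrite -raddf_sum /= detw_distr.
have sumw : \sum_x w x = 1.
  have -> : \sum_x w x = complex.Re (\tr (rho *m \sum_x u x *m (u x ^t*)%sesqui)).
    rewrite /w -raddf_sum /= mulmx_sumr [\tr _]raddf_sum; congr complex.Re.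
    by apply: eq_bigr => x _; rewrite /= mxtrace_rank1.
  by rewrite u_sum mulmx1 rho_tr.
(* Supplies and demands both total 1, so the nonnegative leftovers sum to 0 and all vanish. *)
have gPE F : \sum_x g F x = P F.
  have /psumr_eq0P : \sum_F (P F - \sum_x g F x) = 0.
    rewrite sumrB sumP exchange_big /= (eq_bigr w) ?sumw ?subrr// => x _.
  move=> /(_ (fun F _ => _)) h; apply/esym/eqP; rewrite -subr_eq0 h//.
  by move=> G; rewrite subr_ge0.
exists (steer g); split.
- by move=> F a; rewrite sumr_ge0.
- by move=> F; rewrite sum_steer //; apply: gE.
- by move=> x; rewrite -[RHS]gw; apply: eq_bigr => F _; rewrite sum_steer_eq//; apply: gE.
Qed.

(** Pushing a finite mass forward along [phi] preserves its total, each [o] contributing only at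
    [phi o]. This reduces sums over Bob's infinite output set to finite ones. *)
Lemma esum_fiber (R : realType) (Om : finType) (T : choiceType) (phi : Om -> T) (h : Om -> R) :
  (forall o, 0 <= h o) ->
  \esum_(y in [set: T]) (\sum_(o | phi o == y) h o)%:E = (\sum_o h o)%:E.
Proof.
move=> h0; transitivity (\esum_(y in [set: T]) (\sum_o (if phi o == y then h o else 0)%:E)%E).
  by apply: eq_esum => y _; rewrite sumEFin -big_mkcond.
rewrite esum_sum => [|y o _ _]; last by rewrite lee_fin; case: ifP => // _; apply: h0.
rewrite -sumEFin; apply: eq_bigr => o _.
rewrite -[RHS](@esum_set1 _ _ (phi o) (fun=> (h o)%:E)) ?lee_fin// [RHS]esum_mkcond.
apply: eq_esum => y _; rewrite eq_sym.
by have [->|/eqP yo] := eqVneq y (phi o); [rewrite mem_set|rewrite memNset].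
Qed.

(** * The box *)

Lemma ge0_ReE (R : rcfType) (z : R[i]) : 0 <= z -> z = (complex.Re z)%:C.
Proof. by case: z => a b; rewrite lecE /= => /andP[/eqP-> _]. Qed.

Lemma povm_rank1 (R : realType) n (M : povm R n) :
  exists u : 'I_(outcomes M) * 'I_n -> 'cV[R[i]]_n,
    forall b, M b = \sum_k u (b, k) *m (u (b, k) ^t*)%sesqui.
Proof.
have /choice[U UE] : forall b, exists U : 'M[R[i]]_n, M b = U *m (U ^t*)%sesqui.
  by move=> b; apply: psd_factor; apply: effect_psd.
exists (fun x => col x.2 (U x.1)) => b; rewrite UE; apply/matrixP => i j.
rewrite summxE mxE; apply: eq_bigr => k _.
by rewrite !mxE big_ord1 !mxE.
Qed.

Lemma esum_fin (R : realType) (T : finType) (h : T -> R) : (forall x, 0 <= h x) ->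
  \esum_(x in [set: T]) (h x)%:E = (\sum_x h x)%:E.
Proof.
move=> h0; rewrite -(esum_fiber id h0); apply: eq_esum => y _.
by rewrite big_pred1_eq.
Qed.

Definition dirac_fun (R : pzRingType) (T : eqType) (x y : T) : R := (x == y)%:R.

Lemma dirac_distr (R : realType) (T : countType) (x : T) : is_distr (@dirac_fun R T x).
Proof.
split=> [y|]; first by rewrite ler0n.
have := @esum_fiber R unit T (fun=> x) (fun=> 1) (fun=> ler01).
rewrite big_const card_unit /= addr0 => <-; apply: eq_esum => y _.
by rewrite /dirac_fun; case: eqP => _; [rewrite (big_pred1 tt) //; case|rewrite big_pred0_eq].
Qed.

Section Box.
Variables (R : realType) (n : nat) (M : povm R n.+1).
Local Notation B := {ffun 'I_n.+1 -> nat}.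

(* [p] and [PB] are the box at inputs [(rho, M)] and Bob's marginal. *)
Definition simulates (rho : density R n.+1) (PB : B -> R) (p : 'I_n.+1 * B -> R) :=
  [/\ is_distr p,
      forall a, \esum_(beta in [set: B]) (p (a, beta))%:E = (n.+1%:R^-1)%:E,
      forall beta, \esum_(a in [set: 'I_n.+1]) (p (a, beta))%:E = (PB beta)%:E
    & forall b : 'I_(outcomes M), exists2 t : R, \tr (rho *m M b) = t%:C &
        (\sum_(a < n.+1) \esum_(beta in [set: B])
          (p (a, beta) * dirac_fun R (beta a) b)%:E)%E = t%:E].

(** The order of quantifiers carries half of non-signaling: [PB] is fixed before [rho]. The other
    half is the uniform law of [a] in [simulates]. *)
Lemma povm_box : exists PB : B -> R, forall rho, exists p, simulates rho PB p.
Proof.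
have [u uE] := povm_rank1 M; set X := ('I_(outcomes M) * 'I_n.+1)%type in u uE.
have u_sum : \sum_x u x *m (u x ^t*)%sesqui = 1%:M.
  rewrite -[RHS](effect_sum M) (eq_bigr _ (fun b _ => uE b)) pair_big.
  by apply: eq_bigr => -[].
pose Om := {ffun 'I_n.+1 -> X}.
(* The shared cyclic shift makes Alice's output uniform whatever [M] is. *)
pose lab (o : Om * 'I_n.+1) : B := [ffun a => (o.1 (a + o.2)).1 : nat].
pose c : R := n.+1%:R^-1.
have c_ge0 : 0 <= c by rewrite invr_ge0.
have sum_c (k : R) : \sum_(s < n.+1) k * c = k.
  by rewrite sumr_const card_ord -mulr_natr -mulrA mulVf ?mulr1// pnatr_eq0.
pose P (F : Om) := complex.Re (detw u F / n.+1`!%:R).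
(* The law of the label list when the tuple has determinantal weight and the shift is uniform and
   independent of it. *)
exists (fun beta => \sum_(o | lab o == beta) P o.1 * c) => rho.
have [h [h0 hP hw]] := determinantal_coupling u_sum (density_psd rho) (density_tr rho).
(* Alice sends [a] when the coupling points at the unshifted position [a + o.2], which is where
   [lab] reads its entry [a]. *)
pose h2 a (o : Om * 'I_n.+1) := h o.1 (a + o.2) * c.
have h20 a o : 0 <= h2 a o by rewrite mulr_ge0.
have sumP : \sum_F P F = 1.
  by rewrite -raddf_sum /= detw_distr.
have sum_shift (s : 'I_n.+1) (k : 'I_n.+1 -> R) : \sum_a k (a + s) = \sum_a k a.
  by rewrite [RHS](reindex_inj (addIr s)).
have sum_shift' (a : 'I_n.+1) (k : 'I_n.+1 -> R) : \sum_s k (a + s) = \sum_a k a.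
  by rewrite [RHS](reindex_inj (addrI a)).
have sum_h2 a : \sum_o h2 a o = c.
  rewrite -(pair_big predT predT (fun F s => h F (a + s) * c)) /=.
  under eq_bigr => F _ do rewrite -mulr_suml sum_shift' hP.
  by rewrite -mulr_suml sumP mul1r.
exists (fun y => \sum_(o | lab o == y.2) h2 y.1 o); split.
- split=> [y|]; first by rewrite sumr_ge0.
  transitivity ((\sum_(x : (Om * 'I_n.+1) * 'I_n.+1) h2 x.2 x.1)%:E : \bar R).
    rewrite -(@esum_fiber R _ ('I_n.+1 * B)%type (fun x => (x.2, lab x.1)))//.
    apply: eq_esum => -[a beta] _ /=; congr EFin.
    rewrite -(pair_big_dep predT (fun o a' => (a', lab o) == (a, beta)) (fun o a' => h2 a' o)) /=.
    rewrite big_mkcond; apply: eq_bigr => o _.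
    under eq_bigl do rewrite xpair_eqE andbC.
    by case: eqP => _ /=; rewrite ?big_pred1_eq ?big_pred0_eq.
  rewrite -(pair_big predT predT (fun o a' => h2 a' o)) /= exchange_big /=.
  by under eq_bigr do rewrite sum_h2 -[c]mul1r; rewrite sum_c.
- by move=> a; rewrite -/c -(sum_h2 a); apply: (@esum_fiber R _ B lab (h2 a)) => o.
- move=> beta; rewrite esum_fin => [|a]; last by rewrite sumr_ge0.
  rewrite /= exchange_big /=; congr EFin; apply: eq_bigr => -[F s] _.
  by rewrite /h2 -mulr_suml sum_shift hP.
move=> b; exists (complex.Re (\tr (rho *m M b))).
  apply: ge0_ReE; rewrite uE mulmx_sumr raddf_sum sumr_ge0//= => k _.
  by rewrite mxtrace_rank1; apply: (density_psd rho).
transitivity ((\sum_(a < n.+1) \sum_o h2 a o * dirac_fun R (lab o a) b)%:E : \bar R).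
  rewrite -sumEFin; apply: eq_bigr => a _.
  rewrite -(@esum_fiber _ _ _ lab) => [|o]; last by rewrite mulr_ge0 ?ler0n.
  apply: eq_esum => beta _; rewrite mulr_suml; congr EFin.
  by apply: eq_bigr => o /eqP->.
congr EFin; rewrite exchange_big /=.
rewrite -(pair_big predT predT
  (fun F s => \sum_a h F (a + s) * c * dirac_fun R (lab (F, s) a) b)) /=.
(* The shift of the message cancels that of the list, so averaging over [s] changes nothing. *)
transitivity (\sum_(F : Om) \sum_(s < n.+1) (\sum_a h F a * dirac_fun R ((F a).1 : nat) b) * c).
  apply: eq_bigr => F _; apply: eq_bigr => s _; rewrite -[in RHS](sum_shift s) mulr_suml.
  by apply: eq_bigr => a _; rewrite ffunE mulrAC.
under eq_bigr do rewrite sum_c.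
(* Outcome [b] collects the refined indices [(b, k)], and [hw] gives the probability of each. *)
rewrite uE mulmx_sumr [\tr _]raddf_sum [complex.Re _]raddf_sum /=.
under [RHS]eq_bigr do rewrite (mxtrace_rank1 u) -hw.
rewrite [RHS]exchange_big; apply: eq_bigr => F _ /=.
rewrite [RHS](exchange_big_dep predT) //=; apply: eq_bigr => a _.
rewrite /dirac_fun; case: (F a) => b' k' /=.
have [/val_inj ->|bb'] := eqVneq (b' : nat) b.
  by rewrite mulr1 (big_pred1 k') // => k /=; rewrite xpair_eqE eqxx eq_sym.
by rewrite mulr0 big_pred0 // => k; rewrite xpair_eqE -val_eqE /= (negbTE bb').
Qed.

End Box.

Unset Implicit Arguments.

Theorem mainTheorem2 (R : realType) (nA : nat) (hnA : (0 < nA)%N) :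
  exists (B : countType)
         (p : density R nA -> povm R nA -> 'I_nA * B -> R)
         (q : 'I_nA * B -> nat -> R),
    [/\ nonsignaling p,
        forall (a : 'I_nA) (beta : B), is_distr (q (a, beta))
      & forall (rho : density R nA) (M : povm R nA) (b : 'I_(outcomes M)),
          exists2 t : R,
            \tr (rho *m M b) = t%:C
          & (\sum_(a < nA) \esum_(beta in [set: B])
               (p rho M (a, beta) * q (a, beta) b)%:E)%E = t%:E].
Proof.
(* The successor form equips the positions with cyclic addition. *)
case: nA hnA => // n _.
have /choice[PB PBP] := @povm_box R n.
have /choice[p pP] : forall x : density R n.+1 * povm R n.+1, exists p,
    simulates x.2 x.1 (PB x.2) p.
  by move=> [rho M]; apply: PBP.
exists {ffun 'I_n.+1 -> nat}, (fun rho M => p (rho, M)),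
  (fun y : 'I_n.+1 * {ffun 'I_n.+1 -> nat} => dirac_fun R (y.2 y.1)).
split; first split.
- by move=> rho M; have [] := pP (rho, M).
- move=> rho M M' a; have [_ -> _ _] := pP (rho, M).
  by have [_ -> _ _] := pP (rho, M').
- move=> rho rho' M beta; have [_ _ -> _] := pP (rho, M).
  by have [_ _ -> _] := pP (rho', M).
- by move=> a beta; apply: dirac_distr.
- by move=> rho M b; have [_ _ _] := pP (rho, M); apply.
Qed.
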